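(* Let $(X,\mathcal E_v)$ be an infinite, locally finite, connected tree with root $o$, let $\Phi: X\to\mathcal K$ be a map satisfying (A1) and (A2) (with constants $\delta_0>1$, $0<r<1$), let $\kappa>0$, and let $(X,\mathcal E)$ be the associated augmented tree (a hyperbolic graph), with hyperbolic boundary $\partial X$ and visual metric $\rho_a$. Let $K$ be the attractor of $\Phi$. Then $\partial X$ is Hölder equivalent to $K$: the natural map $\iota:\partial X\to K$, given by $\{\iota(\xi)\}=\bigcap_{n=0}^\infty\Phi(x_n)$ for any geodesic ray $(x_n)_{n\ge0}$ converging to $\xi$, is a (well-defined) bijection, and there is a constant $C>0$ such that $$C^{-1}|\iota(\xi)-\iota(\eta)|\le\rho_a(\xi,\eta)^\beta\le C|\iota(\xi)-\iota(\eta)|\qquad\text{for all }\xi,\eta\in\partial X,$$ with $\beta=-(\log r)/a$.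
   Context: Graphs are undirected and simple. For the tree $(X,\mathcal E_v)$ with root $o$, $|x|$ denotes the length of the non-self-intersecting path from $o$ to $x$, $X_n=\{x\in X:|x|=n\}$, and $\Sigma(x)=\{y\in X: |y|=|x|+1,\ (x,y)\in\mathcal E_v\}$. $\mathcal K$ is the collection of nonempty compact subsets of $\mathbb R^d$; for $E\subset\mathbb R^d$, $|E|$ denotes the diameter, $\mathrm{dist}(E,F)=\inf\{|a-b|:a\in E,b\in F\}$, and for points $|a-b|$ is the Euclidean distance. Conditions on $\Phi:X\to\mathcal K$: (A1) $\Phi(y)\subset\Phi(x)$ for all $x\in X$ and $y\in\Sigma(x)$; (A2) there exist $\delta_0>1$ and $0<r<1$ such that $\delta_0^{-1}r^n\le|\Phi(x)|\le\delta_0 r^n$ for all $n\ge0$ and all $x\in X_n$. Attractor: $K_n=\bigcup\{\Phi(x):x\in X_n\}$ and $K=\bigcap_{n=0}^\infty K_n$. Augmented tree: for a fixed $\kappa>0$, $\mathcal E_h=\{(x,y)\in X\times X:|x|=|y|,\ x\ne y,\ \mathrm{dist}(\Phi(x),\Phi(y))\le\kappa r^{|x|}\}$ and $\mathcal E=\mathcal E_v\cup\mathcal E_h$. Let $d$ be the graph distance of $(X,\mathcal E)$ and $|x\wedge y|=\frac12(|x|+|y|-d(x,y))$ the Gromov product. The graph $(X,\mathcal E)$ is hyperbolic: for some $\delta>0$, $|x\wedge y|\ge\min\{|x\wedge z|,|z\wedge y|\}-\delta$ for all $x,y,z\in X$. Fix $a>0$ small (say $e^{3\delta a}<\sqrt2$)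 and set $\rho_a(x,y)=\exp(-a|x\wedge y|)$ for $x\ne y$ in $X$, $\rho_a(x,x)=0$; $\rho_a$ is equivalent to a metric and is treated as a metric. A sequence $(x_n)$ in $X$ with $|x_n|\to\infty$ is $\rho_a$-Cauchy iff $|x_n\wedge x_m|\to\infty$ as $m,n\to\infty$. The hyperbolic boundary is $\partial X=\widehat X\setminus X$, where $\widehat X$ is the $\rho_a$-completion of $X$. A geodesic ray is a sequence $(x_n)_{n\ge0}$ in $X$ with $x_0=o$, $|x_n|=n$ and $(x_n,x_{n+1})\in\mathcal E_v$ for all $n$; every $\xi\in\partial X$ is the limit of some geodesic ray. For $\xi,\eta\in\partial X$, $|\xi\wedge\eta|=\inf\{\lim_{n\to\infty}|x_n\wedge y_n|\}$, the infimum over all geodesic rays $(x_n)$, $(y_n)$ converging to $\xi$ and $\eta$ respectively, and $\rho_a(\xi,\eta)=\exp(-a|\xi\wedge\eta|)$ for $\xi\neq\eta$, $\rho_a(\xi,\xi)=0$. *)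

(* Defs.v *)
From HB Require Import structures.
From mathcomp Require Import all_boot all_order all_algebra.
From mathcomp Require Import all_classical all_reals all_analysis.

Set Implicit Arguments.
Unset Strict Implicit.
Unset Printing Implicit Defensive.

Import Order.TTheory GRing.Theory Num.Theory.
Import numFieldNormedType.Exports.

Local Open Scope classical_set_scope.
Local Open Scope ring_scope.

Section Euclidean.
Variables (R : realType) (d : nat).
Implicit Types (E F : set 'rV[R]_d).

(* The library norm on 'rV[R]_d is the sup norm; it induces the same topology,
   hence the same compact sets, as the Euclidean norm below. *)
Definition enorm (v : 'rV[R]_d) : R := Num.sqrt (\sum_(i < d) v 0 i ^+ 2).

(* diam and setdist are real-valued: they are meant for nonempty E and F, with
   E bounded in diam. *)
Definition diam E : R := sup [set enorm (a - b) | a in E & b in E].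

Definition setdist E F : R := inf [set enorm (a - b) | a in E & b in F].

End Euclidean.

Section Graph.
Variable X : choiceType.
Implicit Types (e : rel X) (x y o : X).

Definition graph_connected e :=
  forall x y, exists2 p, path e x p & last x p = y.

(* ucycle e c also holds of the degenerate closed walks [::] and [:: x; y],
   whence the bound on the size. *)
Definition acyclic e := forall c, ucycle e c -> (size c <= 2)%N.

Definition is_tree e :=
  [/\ symmetric e, irreflexive e, graph_connected e & acyclic e].

Definition locally_finite_graph e := forall x, finite_set [set y | e x y].

Definition path_length e x y : set nat :=
  [set size p | p in [set p | path e x p /\ last x p = y]].

Definition simple_path_length e x y : set nat :=
  [set size p | p in [set p | [/\ path e x p, last x p = y & uniq (x :: p)]]].

(* In a tree simple_path_length e o x is a singleton, whose element is |x|. *)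
Definition level e o x : nat := xget 0%N (simple_path_length e o x).

(* Minimum of path_length; the default value 0 is only used when x and y are
   not connected. *)
Definition gdist e x y : nat :=
  xget 0%N [set n | path_length e x y n /\
                    forall m, path_length e x y m -> (n <= m)%N].

Definition sons e o x : set X :=
  [set y | level e o y = (level e o x).+1 /\ e x y].

Definition geodesic_ray e o (x : nat -> X) :=
  [/\ x 0%N = o, forall n, level e o (x n) = n & forall n, e (x n) (x n.+1)].

End Graph.

Section IndexMap.
Variables (R : realType) (d : nat) (X : choiceType) (Ev : rel X) (o : X).
Variable Phi : X -> set 'rV[R]_d.

Definition condA1 := forall x y, sons Ev o x y -> Phi y `<=` Phi x.

Definition condA2 (delta0 r : R) :=
  forall (n : nat) (x : X), level Ev o x = n ->
    delta0^-1 * r ^+ n <= diam (Phi x) <= delta0 * r ^+ n.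

Definition attractor : set 'rV[R]_d :=
  \bigcap_n \bigcup_(x in [set x | level Ev o x = n]) Phi x.

Definition Eh (r kappa : R) : rel X := fun x y =>
  [&& level Ev o x == level Ev o y, x != y &
      setdist (Phi x) (Phi y) <= kappa * r ^+ level Ev o x].

Definition augmented (r kappa : R) : rel X :=
  fun x y => Ev x y || Eh r kappa x y.

End IndexMap.

(* The boundary of the rooted graph (X, E), levels and geodesic rays being taken
   with respect to the tree (X, Ev). *)
Section Boundary.
Variables (R : realType) (X : choiceType) (Ev E : rel X) (o : X).
Implicit Types (u v x y : nat -> X) (xi eta : set (nat -> X)).

Definition gromov (x y : X) : R :=
  2^-1 * ((level Ev o x)%:R + (level Ev o y)%:R - (gdist E x y)%:R).

Definition hyperbolic (delta : R) := forall x y z : X,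
  Num.min (gromov x z) (gromov z y) - delta <= gromov x y.

Variable a : R.

Definition rho (x y : X) : R :=
  if x == y then 0 else expR (- (a * gromov x y)).

Definition rho_cauchy u := forall eps : R, 0 < eps ->
  \forall n \near \oo & m \near \oo, rho (u n) (u m) < eps.

Definition rho_equiv u v := (fun n => rho (u n) (v n)) @ \oo --> (0 : R).

(* The completion consists of the classes of Cauchy sequences; X embeds in it
   by the classes of constant sequences. *)
Definition cauchy_class u : set (nat -> X) :=
  [set v | rho_cauchy v /\ rho_equiv u v].

Definition completion : set (set (nat -> X)) :=
  [set cauchy_class u | u in [set u | rho_cauchy u]].

Definition boundary : set (set (nat -> X)) :=
  completion `\` range (fun x : X => cauchy_class (fun=> x)).

(* Convergence in the completion: the distance from x n to the class of v is
   the limit of rho (x n) (v m) as m tends to infinity. *)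
Definition converges_to x xi := forall v, xi v -> forall eps : R, 0 < eps ->
  \forall n \near \oo, \forall m \near \oo, rho (x n) (v m) < eps.

(* The sequence of the gromov (x n) (y n) is nondecreasing along geodesic rays,
   so its limit exists in \bar R. *)
Definition gromov_bdy xi eta : \bar R :=
  ereal_inf [set l | exists x y,
    [/\ geodesic_ray Ev o x /\ converges_to x xi,
        geodesic_ray Ev o y /\ converges_to y eta &
        l = limn (fun n => (gromov (x n) (y n))%:E)]].

Definition rho_bdy xi eta : R :=
  if xi == eta then 0 else fine (expeR (- (a%:E * gromov_bdy xi eta))%E).

End Boundary.

(* Main.v *)
(* Choose a point p_x in each Phi(x) and put D(x, y) = |p_x - p_y| + r^|x| + r^|y|.
   Then r^(|x /\ y|) and D(x, y) bound each other up to constants. On the one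
   hand, consecutive points of a path of the augmented tree satisfy
   |p_z - p_w| <= c r^|z|; summing these geometric bounds along a geodesic, cut
   where they are largest, gives D(x, y) <= C r^(|x /\ y|). On the other hand, x
   and y are joined through their ancestors of the last generation in which these
   are equal or neighbours, while one generation later the cells are separated.
   Since D satisfies the triangle inequality, hyperbolicity follows, and the
   boundary is the set of classes of D-Cauchy sequences, for the relation
   D(u_n, v_n) -> 0. By Koenig's lemma each class contains a geodesic ray, and for
   rays with limit points q and q' in R^d, D(x_n, y_n) converges to |q - q'| up to
   constants; hence r^(|xi /\ eta|) is comparable to |iota(xi) - iota(eta)|, and
   rho_a^beta = r^(|xi /\ eta|). *)
Require Import Defs.
From HB Require Import structures.
From mathcomp Require Import all_boot all_order all_algebra.
From mathcomp Require Import all_classical all_reals all_analysis.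
From mathcomp Require Import ring lra zify.
Set Implicit Arguments.
Unset Strict Implicit.
Unset Printing Implicit Defensive.
Import Order.TTheory GRing.Theory Num.Theory.
Import numFieldNormedType.Exports.
Local Open Scope classical_set_scope.
Local Open Scope ring_scope.

(** * Trees *)

Section Tree.
Variables (X : choiceType) (e : rel X).

Lemma acyclic_simple_path_inj (x : X) (p q : seq X) :
    symmetric e -> acyclic e ->
  path e x p -> path e x q -> uniq (x :: p) -> uniq (x :: q) ->
  last x p = last x q -> p = q.
Proof.
move=> e_sym e_acyc.
elim: p x q => [|a p IHp] x [|b q] //.
- by move=> _ _ _ /andP[xq _] /= xE; rewrite [X in X \notin _]xE mem_last in xq.
- by move=> _ _ /andP[xp _] _ /= xE; rewrite -[X in X \notin _]xE mem_last in xp.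
move=> px qx up uq pq.
have [ab|nab] := eqVneq a b.
  move: px qx up uq pq; rewrite -ab => /andP[_ px] /andP[_ qx].
  by move=> /andP[_ up] /andP[_ uq] pq; congr cons; exact: IHp px qx up uq pq.
(* The part of p up to the first vertex that lies on q closes up with q into a
   cycle through x. *)
have hasq : has (mem (b :: q)) (a :: p).
  apply/hasP; exists (last x (a :: p)); first exact: (mem_last a p).
  by rewrite pq; exact: (mem_last b q).
(* Stated through [head], the inequality survives the splitting of both paths below. *)
have {nab} : head x (a :: p) != head x (b :: q) by [].
move: px up.
case/split_find: {pq IHp} hasq => z p1 p2 zq.
move: qx uq; case/splitPr: {a b p q} zq => q1 q2.
move=> + + p1q + + neq.
rewrite -cat_rcons -cats1 -!cat_cons cats1 !cat_path => /andP[q1_path _] uq.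
move=> /andP[p1_path _] up.
have cyc : ucycle e (x :: rcons p1 z ++ rev q1).
  apply/andP; split.
    rewrite /= rcons_cat cat_path p1_path last_rcons /=.
    by have := rev_path e x (rcons q1 z);
       rewrite last_rcons belast_rcons rev_cons => ->;
       rewrite (eq_path (e' := e)) // => u v; rewrite e_sym.
  have {}uq : uniq (x :: rcons q1 z).
    by move: uq; rewrite cat_uniq cats1 => /andP[].
  have {}up : uniq (x :: rcons p1 z) by move: up; rewrite cat_uniq => /andP[].
  rewrite -cat_cons cat_uniq up /= rev_uniq.
  move: uq; rewrite /= rcons_uniq mem_rcons inE negb_or.
  move=> /andP[/andP[_ xq1] /andP[zq1 ->]]; rewrite andbT.
  apply/hasPn => w; rewrite mem_rev => wq1 /=.
  rewrite inE mem_rcons inE !negb_or.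
  rewrite (memPn xq1 w wq1) (memPn zq1 w wq1) /=.
  by apply: contra p1q => wp1; apply/hasP; exists w => //=; rewrite mem_cat wq1.
(* A length of at most 2 leaves [p1] and [q1] empty; both paths then begin with [z], against
   [neq]. *)
have := e_acyc _ cyc.
rewrite /= size_cat size_rev size_rcons.
by case: p1 q1 neq {p1q q1_path uq p1_path up cyc} => [|? ?] [|? ?] //=;
  rewrite ?eqxx.
Qed.

Hypotheses (e_tree : is_tree e).
Variable o : X.
Notation lev := (level e o).

Lemma tree_simple_path (x : X) :
  exists p, [/\ path e o p, last o p = x & uniq (o :: p)].
Proof.
have [_ _ e_conn _] := e_tree; have [p op px] := e_conn o x.
by case: (shortenP op) px => p' ? ? _ px; exists p'.
Qed.

Lemma level_simple_path (p : seq X) :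
  path e o p -> uniq (o :: p) -> lev (last o p) = size p.
Proof.
move=> op up; rewrite /level; case: xgetP => [n _ [q [oq qp uq] <-]|/(_ (size p))].
  have [e_sym _ _ e_acyc] := e_tree.
  by rewrite (acyclic_simple_path_inj e_sym e_acyc oq op uq up qp).
by case; exists p.
Qed.

Lemma level_root : lev o = 0%N.
Proof. exact: (@level_simple_path [::]). Qed.

Lemma level_eq0 (x : X) : lev x = 0%N -> x = o.
Proof.
by have [[|a p] [op <- up]] := tree_simple_path x; rewrite level_simple_path.
Qed.

(** A simple path from the root to x either avoids y and extends to y, or meets y, and then its part
    up to y extends to x; both extensions are simple. *)
Lemma level_edge (x y : X) : e x y -> lev y = (lev x).+1 \/ lev x = (lev y).+1.
Proof.
have [e_sym e_irr _ _] := e_tree.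
have [p [op <- up]] := tree_simple_path x; move=> pe.
have [yp|yp] := boolP (y \in o :: p); last first.
  left; have := @level_simple_path (rcons p y).
  rewrite last_rcons rcons_path op pe -rcons_cons rcons_uniq yp up.
  by move=> -> //; rewrite size_rcons level_simple_path.
right; move: yp up op pe => /splitPl[p1 p2 <-].
rewrite -cat_cons cat_uniq cat_path last_cat => /and3P[up1 hasp up2] /andP[op1 op2].
case/lastP: p2 op2 hasp up2 => [|p2 x'] _ hasp up2; first by rewrite e_irr.
rewrite last_rcons e_sym => pe.
have xp1 : x' \notin o :: p1.
  by apply: contra hasp => xp1; apply/hasP; exists x' => //; rewrite mem_rcons mem_head.
have := @level_simple_path (rcons p1 x').
rewrite last_rcons rcons_path op1 pe -rcons_cons rcons_uniq xp1 up1.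
by move=> -> //; rewrite size_rcons level_simple_path.
Qed.

(** The default [o] is taken at the root only, so iterating [parent] stays at the root once
    there. *)
Definition parent (x : X) : X := xget o [set y | sons e o y x].

Lemma sons_parent (x : X) : (0 < lev x)%N -> sons e o (parent x) x.
Proof.
rewrite /parent; case: xgetP => [y -> //|none].
have [p [op px up]] := tree_simple_path x; move: op px up.
case/lastP: p => [|p a]; first by move=> _ <-; rewrite level_root.
rewrite last_rcons rcons_path -rcons_cons rcons_uniq.
move=> /andP[op pa] ax /andP[ap up] _; rewrite {}ax in pa ap *.
case: (none (last o p)); split=> //.
have := @level_simple_path (rcons p x).
rewrite last_rcons rcons_path op pa -rcons_cons rcons_uniq ap up.
by move=> -> //; rewrite size_rcons level_simple_path.
Qed.

Lemma level_iter_parent (k : nat) (x : X) :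
  (k <= lev x)%N -> lev (iter k parent x) = (lev x - k)%N.
Proof.
elim: k => [|k IHk] kx; first by rewrite subn0.
have lk := IHk (ltnW kx).
have [|+ _] := @sons_parent (iter k parent x); first by rewrite lk subn_gt0.
by rewrite lk subnS iterS => ->.
Qed.

Lemma sons_iter_parent (k : nat) (x : X) :
  (k < lev x)%N -> sons e o (iter k.+1 parent x) (iter k parent x).
Proof.
by move=> kx; apply: sons_parent; rewrite level_iter_parent ?subn_gt0 // ltnW.
Qed.

Lemma path_iter_parent (k : nat) (x : X) : (k <= lev x)%N ->
  exists2 p, path e x p /\ last x p = iter k parent x & size p = k.
Proof.
have [e_sym _ _ _] := e_tree.
elim: k => [|k IHk] kx; first by exists [::].
have [p [xp pk] sp] := IHk (ltnW kx); exists (rcons p (iter k.+1 parent x)).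
  rewrite last_rcons rcons_path xp pk e_sym.
  by have [_ ->] := sons_iter_parent kx.
by rewrite size_rcons sp.
Qed.

Lemma path_from_iter_parent (k : nat) (x : X) : (k <= lev x)%N ->
  exists2 p, path e (iter k parent x) p /\ last (iter k parent x) p = x
    & size p = k.
Proof.
elim: k => [|k IHk] kx; first by exists [::].
have [p [xp pk] sp] := IHk (ltnW kx); exists (iter k parent x :: p).
  by rewrite /= xp pk; have [_ ->] := sons_iter_parent kx.
by rewrite /= sp.
Qed.

Lemma geodesic_ray_sons (x : nat -> X) (n : nat) :
  geodesic_ray e o x -> sons e o (x n) (x n.+1).
Proof. by case=> _ xl xe; split; rewrite ?xl. Qed.

Hypothesis e_lf : locally_finite_graph e.

(** Koenig's lemma: the root is an ancestor of u_m for arbitrarily large m, and a vertex with this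
    property has a son with the same property, since its sons are finitely many. *)
Lemma koenig (u : nat -> X) :
    (forall N, exists n, forall m, (n <= m)%N -> (N <= lev (u m))%N) ->
  exists2 x, geodesic_ray e o x &
    forall n N, exists2 m, (N <= m)%N &
      (n <= lev (u m))%N /\ x n = iter (lev (u m) - n) parent (u m).
Proof.
move=> u_infty.
pose Q (x : X) m := (lev x <= lev (u m))%N /\
  x = iter (lev (u m) - lev x) parent (u m).
pose P x := forall N, exists2 m, (N <= m)%N & Q x m.
have Po : P o.
  move=> N; exists N => //; rewrite /Q level_root subn0; split=> //.
  by apply/esym/level_eq0; rewrite level_iter_parent // subnn.
have P_son x : P x -> exists y, sons e o x y /\ P y.
  move=> Px; apply: contrapT => noy.
  have {noy} noP y : exists N, sons e o x y -> forall m, (N <= m)%N -> ~ Q y m.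
    apply: contrapT => /forallNP noN; apply: noy; exists y.
    have xy : sons e o x y by have /not_implyP[] := noN 0%N.
    split=> // N; apply: contrapT => noQ; apply: (noN N) => _ m Nm Qm.
    by apply: noQ; exists m.
  have [N NQ] := choice noP.
  have /finite_seqP[s xs] : finite_set [set y | e x y] by exact: e_lf.
  have [n n_u] := u_infty (lev x).+1.
  (* Past these bounds u_m lies deeper than x, yet no son of x may lead to it; the ancestor of u_m
     at level |x| + 1 is such a son. *)
  have [m nm [xm xE]] := Px (maxn n (\max_(y <- s) N y)).
  move: nm; rewrite geq_max => /andP[nm sm].
  have xlt : (lev x < lev (u m))%N by exact: n_u.
  set y := iter (lev (u m) - (lev x).+1) parent (u m).
  have xy : sons e o x y.
    rewrite /y [X in sons e o X]xE.
    by rewrite -[in X in sons _ _ (iter X _ _)]subSS subSn //; apply: sons_iter_parent; lia.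
  have ys : y \in s.
    by have : [set` s] y by rewrite -xs; case: xy.
  apply: (NQ y xy m).
    by apply: leq_trans sm; exact: leq_bigmax_seq.
  by split; case: (xy) => -> _.
have /choice[f f_son] x : exists y, P x -> sons e o x y /\ P y.
  have [Px|nPx] := pselect (P x); last by exists o.
  by have [y] := P_son x Px; exists y.
have Pf n : P (iter n f o) by elim: n => [|n /f_son[]].
have lf n : lev (iter n f o) = n.
  by elim: n => [|n IHn]; rewrite ?level_root // iterS; have [[-> _]] := f_son _ (Pf n); rewrite IHn.
exists (fun n => iter n f o).
  by split=> // n; have [[]] := f_son _ (Pf n).
by move=> n N; have [m Nm [le_m /esym xE]] := Pf n N; exists m; rewrite ?lf // in le_m xE *.
Qed.

End Tree.

(** * Graph distance *)

Section GraphDistance.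
Variables (X : choiceType) (e : rel X).
Hypothesis e_conn : graph_connected e.

Lemma gdist_path (x y : X) :
  exists p, [/\ path e x p, last x p = y & size p = gdist e x y].
Proof.
have [p0 xp0 p0y] := e_conn x y.
have ex_len : exists n, `[< path_length e x y n >].
  by exists (size p0); apply/asboolP; exists p0.
rewrite /gdist; case: xgetP => [n _ [[p [xp py] <-] _]|/(_ (ex_minn ex_len))].
  by exists p.
case; case: ex_minnP => n /asboolP nP n_min; split=> // m mP.
exact/n_min/asboolP.
Qed.

Lemma gdist_le (x y : X) (p : seq X) :
  path e x p -> last x p = y -> (gdist e x y <= size p)%N.
Proof.
move=> xp py; have [q [xq qy sq]] := gdist_path x y.
move: sq; rewrite /gdist; case: xgetP => [n _ [_ n_min] _|_ _].
  by apply: n_min; exists p.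
by [].
Qed.

Lemma gdist_triangle (x y z : X) : (gdist e x z <= gdist e x y + gdist e y z)%N.
Proof.
have [p [xp py <-]] := gdist_path x y; have [q [yq qz <-]] := gdist_path y z.
by rewrite -size_cat gdist_le // ?cat_path ?last_cat ?xp py.
Qed.

Lemma gdist_edge (x y : X) : e x y -> (gdist e x y <= 1)%N.
Proof. by move=> xy; apply: (@gdist_le x y [:: y]); rewrite //= xy. Qed.

End GraphDistance.

(** * Euclidean norm, diameters and distances of sets *)

Section Enorm.
Variables (R : realType) (d : nat).
Implicit Types (u v w : 'rV[R]_d).

Lemma enorm_ge0 v : 0 <= enorm v. Proof. exact: sqrtr_ge0. Qed.

Lemma enorm0 : enorm (0 : 'rV[R]_d) = 0.
Proof. by rewrite /enorm big1 ?sqrtr0 // => i _; rewrite mxE expr0n. Qed.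

Lemma enormN v : enorm (- v) = enorm v.
Proof. by congr Num.sqrt; apply: eq_bigr => i _; rewrite mxE sqrrN. Qed.

Lemma enormB u v : enorm (u - v) = enorm (v - u).
Proof. by rewrite -opprB enormN. Qed.

Lemma sum_sqr_ge0 v : 0 <= \sum_(i < d) v 0 i ^+ 2.
Proof. by apply: sumr_ge0 => i _; exact: sqr_ge0. Qed.

Lemma sqr_enorm v : enorm v ^+ 2 = \sum_(i < d) v 0 i ^+ 2.
Proof. exact/sqr_sqrtr/sum_sqr_ge0. Qed.

Lemma coord_le_enorm v i : `|v 0 i| <= enorm v.
Proof.
rewrite -sqrtr_sqr ler_wsqrtr // (bigD1 i) //= lerDl.
by apply: sumr_ge0 => j _; exact: sqr_ge0.
Qed.

Lemma enorm_eq0 v : enorm v = 0 -> v = 0.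
Proof.
move=> v0; apply/rowP => i; rewrite mxE; apply/eqP.
by rewrite -normr_le0 -v0 coord_le_enorm.
Qed.

(** Cauchy-Schwarz: the sum of the squares of |v| u_i - |u| v_i equals 2 |u| |v| (|u| |v| - u.v).
    Zero vectors are set apart so that |u| |v| can be cancelled. *)
Lemma dot_le_enorm u v : \sum_(i < d) u 0 i * v 0 i <= enorm u * enorm v.
Proof.
have [u0|u_neq0] := eqVneq (enorm u) 0.
  by rewrite (enorm_eq0 u0) enorm0 mul0r big1 // => i _; rewrite mxE mul0r.
have [v0|v_neq0] := eqVneq (enorm v) 0.
  by rewrite (enorm_eq0 v0) enorm0 mulr0 big1 // => i _; rewrite mxE mulr0.
have u_gt0 : 0 < enorm u by rewrite lt_def u_neq0 enorm_ge0.
have v_gt0 : 0 < enorm v by rewrite lt_def v_neq0 enorm_ge0.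
have : 0 <= \sum_(i < d) (enorm v * u 0 i - enorm u * v 0 i) ^+ 2.
  by apply: sumr_ge0 => i _; exact: sqr_ge0.
under eq_bigr do rewrite sqrrB !exprMn.
rewrite big_split sumrB /= -!mulr_sumr -!sqr_enorm.
have -> : \sum_(i < d) enorm v * u 0 i * (enorm u * v 0 i) *+ 2 =
    2 * (enorm u * enorm v) * \sum_(i < d) u 0 i * v 0 i.
  by rewrite mulr_sumr; apply: eq_bigr => i _; ring.
have uv_gt0 := mulr_gt0 u_gt0 v_gt0.
move=> H; rewrite -(ler_pM2l uv_gt0); lra.
Qed.

Lemma ler_enormD u v : enorm (u + v) <= enorm u + enorm v.
Proof.
rewrite -(@ler_pXn2r _ 2) ?nnegrE ?addr_ge0 ?enorm_ge0 //.
rewrite sqr_enorm sqrrD !sqr_enorm.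
under eq_bigr do rewrite mxE sqrrD.
rewrite 2!big_split /= lerD2r lerD2l sumrMnl lerMn2r.
exact: dot_le_enorm.
Qed.

Lemma enorm_triangle w u v : enorm (u - v) <= enorm (u - w) + enorm (w - v).
Proof. by have := ler_enormD (u - w) (w - v); rewrite addrA subrK. Qed.

(** Positivity of [diam A] certifies that the supremum exists, since [sup] takes the value 0
    otherwise. *)
Lemma enorm_le_diam (A : set 'rV[R]_d) u v :
  0 < diam A -> A u -> A v -> enorm (u - v) <= diam A.
Proof.
move=> A_gt0 Au Av; apply: sup_upper_bound; last by exists u => //; exists v.
by apply: contrapT => /sup_out A0; rewrite /diam A0 ltxx in A_gt0.
Qed.

Let has_inf_enorm (A B : set 'rV[R]_d) : A !=set0 -> B !=set0 ->
  has_inf [set enorm (a - b) | a in A & b in B].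
Proof.
move=> [a Aa] [b Bb]; split; first by exists (enorm (a - b)), a => //; exists b.
by exists 0 => _ [? _ [? _ <-]]; exact: enorm_ge0.
Qed.

Lemma setdist_le_enorm (A B : set 'rV[R]_d) u v :
  A u -> B v -> setdist A B <= enorm (u - v).
Proof.
move=> Au Bv; apply: ge_inf; last by exists u => //; exists v.
by apply: (has_inf_enorm _ _).2; [exists u|exists v].
Qed.

Lemma setdist_lt_enorm (A B : set 'rV[R]_d) (s : R) :
  A !=set0 -> B !=set0 -> setdist A B < s ->
  exists u v, [/\ A u, B v & enorm (u - v) < s].
Proof.
move=> A0 B0 ABs; have s_gt0 : 0 < s - setdist A B by rewrite subr_gt0.
have [_ [u Au [v Bv <-]]] := inf_adherent s_gt0 (has_inf_enorm A0 B0).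
by rewrite -/(setdist A B) => uv; exists u, v; split=> //; lra.
Qed.

End Enorm.

(** * Nested compact sets and eventual properties *)

Lemma compact_nested_nonempty (T : topologicalType) (F : nat -> set T) :
    hausdorff_space T -> (forall n, F n !=set0) -> (forall n, compact (F n)) ->
    (forall n, F n.+1 `<=` F n) ->
  (\bigcap_n F n) !=set0.
Proof.
move=> T_sep F0 Fc F_dec.
have F_le m n : (m <= n)%N -> F n `<=` F m.
  elim: n => [|n IHn]; first by rewrite leqn0 => /eqP->.
  by rewrite leq_eqVlt => /predU1P[->//|/IHn mn]; exact: subset_trans mn.
have /choice[f Ff] : forall n, exists x, F n x by exact: F0.
(* The tail of f lies in each closed set [F n], hence so does any cluster point. *)
have near_F n : (f @ \oo) (F n) by exists n => // m /= nm; exact: F_le (Ff m).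
have [x [_ x_cl]] := Fc 0%N _ _ (near_F 0%N).
exists x => n _; apply: (compact_closed T_sep (Fc n)) => B xB.
exact: x_cl (near_F n) xB.
Qed.

Lemma near_ooP (P : nat -> Prop) :
  (\forall n \near \oo, P n) <-> exists N, forall n, (N <= n)%N -> P n.
Proof. by split=> [[N _ NP]|[N NP]]; exists N. Qed.

Lemma near_oo2P (P : nat -> nat -> Prop) :
  (\forall n \near \oo & m \near \oo, P n m) <->
  exists N, forall n m, (N <= n)%N -> (N <= m)%N -> P n m.
Proof.
split=> [[[A B] [/= [N _ NA] [M _ MB]] AB]|[N NP]].
  exists (maxn N M) => n m; rewrite !geq_max => /andP[Nn _] /andP[_ Mm].
  by apply: (AB (n, m)); split; [exact: NA|exact: MB].
exists ([set n | (N <= n)%N], [set n | (N <= n)%N]); first by split; exists N.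
by case=> n m [/= Nn Nm]; exact: NP.
Qed.

(* A path of length s from level l to level m is cut after i steps, where the
   bounds l - i and m - (s - i) on the level of its points agree up to 1. *)
Lemma path_midpoint (l m s : nat) : (l <= m + s)%N -> (m <= l + s)%N ->
  exists i, [/\ (i <= s)%N, (2 * i + m <= s + l)%N & (s + l <= 2 * i + m + 1)%N].
Proof. by move=> lm ml; exists (s + l - m)./2; split; lia. Qed.

(** * Cells of the index map *)

Section AugmentedTree.
Variables (R : realType) (d : nat) (X : choiceType) (Ev : rel X) (o : X).
Variables (Phi : X -> set 'rV[R]_d) (delta0 r kappa : R).
Hypotheses (Ev_tree : is_tree Ev)
  (PhiK : forall x : X, Phi x !=set0 /\ compact (Phi x))
  (delta0_gt1 : 1 < delta0) (r01 : 0 < r < 1)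
  (PhiA1 : condA1 Ev o Phi) (PhiA2 : condA2 Ev o Phi delta0 r)
  (kappa_gt0 : 0 < kappa).
Notation lev := (level Ev o).
Notation E := (augmented Ev o Phi r kappa).
Notation gromov := (gromov R Ev E o).

Let r_gt0 : 0 < r. Proof. by case/andP: r01. Qed.
Let r_lt1 : r < 1. Proof. by case/andP: r01. Qed.
Let delta0_gt0 : 0 < delta0. Proof. exact: lt_trans delta0_gt1. Qed.
Let constant_bounds : [/\ 0 < kappa, 1 < delta0, 0 < r & r < 1].
Proof. by []. Qed.
Let Ev_sym : symmetric Ev. Proof. by case: Ev_tree. Qed.

Definition pt (x : X) : 'rV[R]_d := xget 0 (Phi x).

(** The quantity D: the terms r^|x| and r^|y| stand for the sizes of the cells. Thus D(x, x) = 2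
    r^|x| is positive, and D(x, y) is small only if both levels are large. *)
Definition cell_dist (x y : X) : R := enorm (pt x - pt y) + r ^+ lev x + r ^+ lev y.

Lemma Phi_pt (x : X) : Phi x (pt x).
Proof. by rewrite /pt; have [[q xq] _] := PhiK x; case: xgetP => [? ->//|/(_ q)]. Qed.

Lemma cell_dist_gt0 (x y : X) : 0 < cell_dist x y.
Proof. by rewrite ltr_wpDl ?exprn_gt0// addr_ge0 ?enorm_ge0// exprn_ge0// ltW. Qed.

Lemma cell_dist_sym (x y : X) : cell_dist x y = cell_dist y x.
Proof. by rewrite /cell_dist enormB addrAC. Qed.

Lemma cell_dist_triangle (x y z : X) : cell_dist x z <= cell_dist x y + cell_dist y z.
Proof.
rewrite /cell_dist; have := enorm_triangle (pt y) (pt x) (pt z).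
have : 0 < r ^+ lev y by exact: exprn_gt0.
lra.
Qed.

Lemma expr_level_le_cell_dist (x y : X) : r ^+ lev x <= cell_dist x y.
Proof.
rewrite /cell_dist; have := enorm_ge0 (pt x - pt y).
have : 0 < r ^+ lev y by exact: exprn_gt0.
lra.
Qed.

(** The lower bound of (A2) makes the diameter positive, as [enorm_le_diam] requires. *)
Lemma enorm_le_Phi (x : X) (u v : 'rV[R]_d) :
  Phi x u -> Phi x v -> enorm (u - v) <= delta0 * r ^+ lev x.
Proof.
move=> xu xv; have /andP[lo hi] := PhiA2 (erefl (lev x)).
apply: le_trans hi; apply: enorm_le_diam => //; apply: lt_le_trans lo.
by rewrite mulr_gt0 ?invr_gt0 // exprn_gt0.
Qed.

Lemma Phi_iter_parent (k : nat) (x : X) :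
  (k <= lev x)%N -> Phi x `<=` Phi (iter k (parent Ev o) x).
Proof.
elim: k => [|k IHk] kx //; apply: subset_trans (IHk (ltnW kx)) _.
exact: PhiA1 (sons_iter_parent Ev_tree kx).
Qed.

Lemma augmented_connected : graph_connected E.
Proof.
have [_ _ conn _] := Ev_tree => x y; have [p xp py] := conn x y.
by exists p => //; apply: sub_path xp => u v uv; rewrite /augmented uv.
Qed.

Lemma augmented_Ev (x y : X) : Ev x y -> E x y.
Proof. by rewrite /augmented => ->. Qed.

Lemma augmented_level (x y : X) :
  E x y -> (lev x <= (lev y).+1)%N /\ (lev y <= (lev x).+1)%N.
Proof.
case/orP => [/(level_edge Ev_tree o)[->|->]|/and3P[/eqP-> _ _]]; lia.
Qed.

Lemma augmented_path_level (x : X) (p : seq X) : path E x p ->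
  (lev x <= lev (last x p) + size p)%N /\ (lev (last x p) <= lev x + size p)%N.
Proof.
elim: p x => [|y p IHp] x /=; first by rewrite addn0.
by move=> /andP[/augmented_level xy /IHp]; lia.
Qed.

Lemma level_le_gdist (x y : X) :
  (lev x <= lev y + gdist E x y)%N /\ (lev y <= lev x + gdist E x y)%N.
Proof.
have [p [xp <- <-]] := gdist_path augmented_connected x y.
exact: augmented_path_level.
Qed.

(* For horizontal edges: two diameters and the gap between the cells, the latter
   exceeded by at most r^|x| since the infimum setdist need not be attained.
   For vertical edges: the diameter of the larger cell, at level |x| or |x| - 1. *)
Definition step_const : R := (2 * delta0 + kappa + 1) / r.

Lemma step_const_ge0 : 0 <= step_const.
Proof. have [kp dp rp _] := constant_bounds; rewrite /step_const divr_ge0 ?ltW//; lra. Qed.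

Lemma enorm_augmented (x y : X) :
  E x y -> enorm (pt x - pt y) <= step_const * r ^+ lev x.
Proof.
have [kp dp rp rl] := constant_bounds.
have rx : 0 < r ^+ lev x by exact: exprn_gt0.
have ry : 0 < r ^+ lev y by exact: exprn_gt0.
rewrite /step_const mulrAC ler_pdivlMr //.
have er : enorm (pt x - pt y) * r <= enorm (pt x - pt y).
  by rewrite ler_piMr ?enorm_ge0 // ltW.
have krx : 0 < kappa * r ^+ lev x by exact: mulr_gt0.
have drx : 0 < delta0 * r ^+ lev x by exact: mulr_gt0.
case/orP => [xy|/and3P[/eqP xy _ dxy]]; last first.
  have [u [v [xu yv uv]]] : exists u v, [/\ Phi x u, Phi y v &
      enorm (u - v) < (kappa + 1) * r ^+ lev x].
    have [x0 _] := PhiK x; have [y0 _] := PhiK y.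
    by apply: setdist_lt_enorm => //; apply: le_lt_trans dxy _; nra.
  have := enorm_triangle u (pt x) (pt y); have := enorm_triangle v u (pt y).
  have := enorm_le_Phi (Phi_pt x) xu; have := enorm_le_Phi yv (Phi_pt y).
  rewrite -xy; lra.
have [xy'|xy'] := level_edge Ev_tree o xy.
  have /PhiA1/(_ _ (Phi_pt y)) yx : sons Ev o x y by [].
  have := enorm_le_Phi (Phi_pt x) yx; lra.
have /PhiA1/(_ _ (Phi_pt x)) yx : sons Ev o y x by split=> //; rewrite Ev_sym.
(* Here |y| = |x| - 1, and multiplying by r turns r^|y| into r^|x|; the division by r in
   [step_const] pays for this. *)
have := enorm_le_Phi yx (Phi_pt y); rewrite -(ler_pM2r rp) -mulrA -exprSr -xy'.
lra.
Qed.

(* The sum of the geometric series bounding the steps of a path. *)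
Definition path_const : R := step_const / (1 - r).

(** The fixed-point equation of the geometric sum, which closes the inductions on paths. *)
Let path_constE : step_const + r * path_const = path_const.
Proof. by have [kp dp rp rl] := constant_bounds; rewrite /path_const; field; lra. Qed.

Lemma path_const_ge0 : 0 <= path_const.
Proof. by rewrite /path_const divr_ge0 ?step_const_ge0 // subr_ge0 ltW. Qed.

(** After i steps the level is at least |x| - i, so the steps are bounded by a geometric sum of
    order r^(|x| - s), s being the length. The factor r^s on the left avoids negative exponents. *)
Lemma enorm_path_left (x : X) (p : seq X) : path E x p ->
  r ^+ size p * enorm (pt x - pt (last x p)) <= path_const * r ^+ lev x.
Proof.
elim/last_ind: p => [|p y IHp].
  rewrite /= subrr enorm0 mulr0 => _.
  by rewrite mulr_ge0 ?path_const_ge0 // exprn_ge0 // ltW.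
have [kp dp rp rl] := constant_bounds.
rewrite rcons_path last_rcons size_rcons => /andP[xp py].
have h1 := IHp xp; have h2 := enorm_augmented py.
have h3 := enorm_triangle (pt (last x p)) (pt x) (pt y).
have h4 : r ^+ size p * r ^+ lev (last x p) <= r ^+ lev x.
  rewrite -exprD ler_wiXn2l ?ltW //.
  by rewrite addnC; have [] := augmented_path_level xp.
have h5 : r ^+ size p * enorm (pt (last x p) - pt y) <= step_const * r ^+ lev x.
  apply: le_trans (_ : step_const * (r ^+ size p * r ^+ lev (last x p)) <= _).
    by rewrite mulrCA ler_wpM2l // exprn_ge0 // ltW.
  by rewrite ler_wpM2l // step_const_ge0.
rewrite -path_constE exprS.
apply: le_trans (_ : r * (r ^+ size p * (enorm (pt x - pt (last x p)) +
   enorm (pt (last x p) - pt y))) <= _).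
  by rewrite mulrA ler_wpM2l // mulr_ge0 ?exprn_ge0 // ltW.
rewrite [step_const + _]addrC [X in r * X]mulrDr mulrDr mulrDl lerD //.
  by rewrite -mulrA ler_wpM2l // ltW.
apply: le_trans h5; apply: ler_piMl; last exact: ltW.
by rewrite mulr_ge0 ?enorm_ge0 // exprn_ge0 // ltW.
Qed.

(** The mirror image: levels are bounded from the end of the path, and the induction removes the
    first vertex. *)
Lemma enorm_path_right (x : X) (p : seq X) : path E x p ->
  r ^+ size p * enorm (pt x - pt (last x p)) <= path_const * r ^+ lev (last x p).
Proof.
have [kp dp rp rl] := constant_bounds.
elim: p x => [|y p IHp] x.
  rewrite /= subrr enorm0 mulr0 => _.
  by rewrite mulr_ge0 ?path_const_ge0 // exprn_ge0 // ltW.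
move=> xp; have := augmented_path_level xp; move: xp.
rewrite /= => /andP[xy yp] [_ xl].
have h1 := IHp y yp; have h2 := enorm_augmented xy.
set z := last y p in xl h1 *.
have h3 := enorm_triangle (pt y) (pt x) (pt z).
have h4 : r ^+ (size p).+1 * enorm (pt x - pt y) <= step_const * r ^+ lev z.
  apply: le_trans (_ : step_const * (r ^+ (size p).+1 * r ^+ lev x) <= _).
    by rewrite mulrCA ler_wpM2l // exprn_ge0 // ltW.
  rewrite ler_wpM2l ?step_const_ge0 // -exprD ler_wiXn2l ?ltW //.
  by rewrite addnC.
apply: le_trans (_ : r ^+ (size p).+1 *
    (enorm (pt x - pt y) + enorm (pt y - pt z)) <= _).
  by rewrite ler_wpM2l // exprn_ge0 // ltW.
rewrite -path_constE mulrDr mulrDl lerD // exprS -mulrA -[X in _ <= X]mulrA.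
by rewrite ler_wpM2l // ltW.
Qed.

(** * Gromov product and distance between cells *)

Let le_powR (s t : R) : s <= t -> r `^ t <= r `^ s.
Proof. by apply: ger_powR; rewrite r_gt0 ltW. Qed.

Let powR_le_inj (s t : R) : r `^ s <= r `^ t -> t <= s.
Proof.
apply: contraTT; rewrite -!ltNge /powR (gt_eqF r_gt0) => st.
by rewrite ltr_expR ltr_nM2r // ln_lt0.
Qed.

(** Turns a path bound, with r^i still on the left, into a bound by a real power; Gromov products
    are half-integers. *)
Let le_powR_of_expr (i n : nat) (c s t : R) : 0 <= c ->
  r ^+ i * s <= c * r ^+ n -> t <= n%:R - i%:R -> s <= c * r `^ t.
Proof.
move=> c_ge0 h tin; apply: le_trans (_ : c * r `^ (n%:R - i%:R) <= _); last first.
  by rewrite ler_wpM2l // le_powR.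
rewrite -(ler_pM2l (exprn_gt0 i r_gt0)); apply: le_trans h _.
rewrite mulrCA -!powR_mulrn ?(ltW r_gt0) // -powRD ?(gt_eqF r_gt0) ?implybT //.
by rewrite subrKC.
Qed.

Lemma gromov_le_level (x y : X) :
  gromov x y <= (lev x)%:R /\ gromov x y <= (lev y)%:R.
Proof.
have [] := level_le_gdist x y; rewrite -!(ler_nat R) !natrD /Defs.gromov.
by move=> h1 h2; split; lra.
Qed.

(** A geodesic of length s is cut after i steps, where |x| - i and |y| - (s - i) both agree with the
    Gromov product up to rounding; each half obeys one of the path bounds. *)
Lemma cell_dist_le_powR_gromov :
  exists2 C : R, 0 < C & forall x y, cell_dist x y <= C * r `^ gromov x y.
Proof.
have pc := path_const_ge0; have [kp dp rp rl] := constant_bounds.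
have rV : 0 < r^-1 by rewrite invr_gt0.
(* The term 1/r covers the rounding in the second half, and 2 covers r^|x| + r^|y|. *)
exists (path_const * (1 + r^-1) + 2).
  by rewrite ltr_wpDl // mulr_ge0 // addr_ge0 // ltW.
move=> x y; have [gx gy] := gromov_le_level x y.
have [p [xp py sp]] := gdist_path augmented_connected x y.
have [lxy lyx] := level_le_gdist x y; rewrite -sp in lxy lyx.
have [i [ip i_lo i_hi]] := path_midpoint lxy lyx.
have s1 : size (take i p) = i by apply: size_takel.
have s2 : size (drop i p) = (size p - i)%N by rewrite size_drop.
move: xp py; rewrite -{1 2}(cat_take_drop i p) cat_path last_cat.
move=> /andP[xp1 p2] py.
have := enorm_path_left xp1; have := enorm_path_right p2.
rewrite py s1 s2; set z := last x _ => h2 h1.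
have gE : 2 * gromov x y = (lev x)%:R + (lev y)%:R - (size p)%:R.
  by rewrite /Defs.gromov sp; lra.
move: i_lo i_hi; rewrite -!(ler_nat R) !natrD => i_lo i_hi.
have {}h1 : enorm (pt x - pt z) <= path_const * r `^ gromov x y.
  by apply: le_powR_of_expr h1 _ => //; lra.
have {}h2 : enorm (pt z - pt y) <= path_const * r `^ (gromov x y - 1).
  by apply: le_powR_of_expr h2 _ => //; rewrite natrB //; lra.
have rgE : r `^ (gromov x y - 1) = r `^ gromov x y * r^-1.
  by rewrite powRD ?(gt_eqF rp) ?implybT // powR_inv1 // ltW.
have := enorm_triangle (pt z) (pt x) (pt y).
have := le_powR gx; have := le_powR gy; rewrite !powR_mulrn ?(ltW r_gt0) // /cell_dist.
rewrite {}rgE in h2 *; lra.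
Qed.

Lemma powR_gromov_le_cell_dist :
  exists2 C : R, 0 < C & forall x y, r `^ gromov x y <= C * cell_dist x y.
Proof.
have [kp dp rp rl] := constant_bounds.
have rV : 0 < r^-1 by rewrite invr_gt0.
have kV : 0 < kappa^-1 by rewrite invr_gt0.
(* The factor 1/r pays for the exponent n - 1 in place of n; 1 is for n = min(|x|, |y|), and
   1/(kappa r) for cells separated at level n + 1. *)
exists (r^-1 * (1 + (kappa * r)^-1)).
  by rewrite mulr_gt0 // addr_gt0 // invr_gt0 mulr_gt0.
move=> x y; pose anc n z := iter (lev z - n) (parent Ev o) z.
pose near_anc n := (n <= minn (lev x) (lev y))%N &&
  ((anc n x == anc n y) || E (anc n x) (anc n y)).
have anc0 z : anc 0%N z = o.
  by apply: (level_eq0 Ev_tree); rewrite /anc level_iter_parent ?leq_subr // subKn.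
have ex_near : exists n, near_anc n by exists 0%N; rewrite /near_anc !anc0 eqxx.
(* In the last generation n where the ancestors of x and y are equal or
   neighbours they give a short path from x to y; in the next one the cells of
   the ancestors, hence pt x and pt y, are more than kappa r^(n+1) apart. *)
have near_le n : near_anc n -> (n <= minn (lev x) (lev y))%N by case/andP.
case: (ex_maxnP ex_near near_le) => n /andP[n_le n_near] n_max.
have [nx ny] : (n <= lev x)%N /\ (n <= lev y)%N.
  by move: n_le; rewrite leq_min => /andP.
(* The path through the ancestors has length at most |x| + |y| - 2n + 1. *)
have g_ge : n%:R - 1 <= gromov x y.
  have [p1 [xp1 p1z] s1] := path_iter_parent Ev_tree (leq_subr n (lev x)).
  have [p2 [yp2 p2y] s2] := path_from_iter_parent Ev_tree (leq_subr n (lev y)).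
  have h1 := gdist_le augmented_connected (sub_path augmented_Ev xp1) p1z.
  have h2 := gdist_le augmented_connected (sub_path augmented_Ev yp2) p2y.
  have h3 : (gdist E (anc n x) (anc n y) <= 1)%N.
    have /orP[/eqP->|] := n_near; last exact: gdist_edge augmented_connected _ _.
    apply: leq_trans (_ : 0 <= 1)%N => //.
    exact: (@gdist_le _ _ augmented_connected _ _ [::]).
  have : (gdist E x y <= (lev x - n) + 1 + (lev y - n))%N.
    rewrite s1 in h1; rewrite s2 in h2.
    have h4 := gdist_triangle augmented_connected x (anc n x) (anc n y).
    have h5 := gdist_triangle augmented_connected x (anc n y) y.
    apply: leq_trans h5 _; apply: leq_add => //.
    by apply: leq_trans h4 _; apply: leq_add.
  rewrite -(ler_nat R) !natrD !natrB // /Defs.gromov; lra.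
have rn : r ^+ n <= (1 + (kappa * r)^-1) * cell_dist x y.
  have D0 := cell_dist_gt0 x y.
  have kr : 0 < (kappa * r)^-1 by rewrite invr_gt0 mulr_gt0.
  have [n_lt|n_ge] := ltnP n (minn (lev x) (lev y)); last first.
    apply: le_trans (_ : cell_dist x y <= _); last by rewrite ler_peMl ?lerDl // ltW.
    have -> : n = minn (lev x) (lev y) by apply/eqP; rewrite eqn_leq n_le.
    case: leqP => _; first exact: expr_level_le_cell_dist.
    by rewrite cell_dist_sym; exact: expr_level_le_cell_dist.
  have [nx' ny'] : (n.+1 <= lev x)%N /\ (n.+1 <= lev y)%N.
    by move: n_lt; rewrite leq_min => /andP.
  have : ~~ near_anc n.+1 by apply/negP => /n_max; rewrite ltnn.
  have ancl z : (n.+1 <= lev z)%N -> lev (anc n.+1 z) = n.+1.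
    by move=> nz; rewrite /anc level_iter_parent ?leq_subr // subKn.
  rewrite /near_anc n_lt /= negb_or /augmented /Eh => /andP[-> /norP[_]].
  rewrite !ancl // eqxx /= -ltNge => kr_lt.
  have anc_pt z : Phi (anc n.+1 z) (pt z).
    exact: Phi_iter_parent (leq_subr _ _) _ (Phi_pt z).
  have {}kr_lt := lt_le_trans kr_lt (setdist_le_enorm (anc_pt x) (anc_pt y)).
  apply: le_trans (_ : (kappa * r)^-1 * cell_dist x y <= _).
    rewrite ler_pdivlMl ?mulr_gt0 // -mulrA -exprS.
    rewrite /cell_dist; apply: le_trans (ltW kr_lt) _.
    by rewrite -addrA lerDl addr_ge0 // exprn_ge0 // ltW.
  by rewrite ler_wpM2r ?lerDr // ltW.
apply: le_trans (le_powR g_ge) _.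
rewrite powRD ?(gt_eqF rp) ?implybT // powR_inv1 ?(ltW r_gt0) // powR_mulrn ?(ltW r_gt0) //.
by rewrite mulrC -mulrA ler_wpM2l // ltW.
Qed.

(** The triangle inequality for D bounds r^|x /\ y| by 2 C1 C2 r^m, with m the smaller of the other
    two products; logarithms turn the factor into an additive constant. *)
Lemma augmented_hyperbolic :
  exists2 delta : R, 0 < delta & hyperbolic Ev E o delta.
Proof.
have [kp dp rp rl] := constant_bounds.
have [C1 C1_gt0 C1P] := cell_dist_le_powR_gromov; have [C2 C2_gt0 C2P] := powR_gromov_le_cell_dist.
have C_gt0 := mulr_gt0 C1_gt0 C2_gt0.
have lnr : 0 < - ln r by rewrite oppr_gt0 ln_lt0 // r01.
(* The summand 1 gives C > 1, hence a positive delta, for which r^(-delta) = C. *)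
pose C := 1 + 2 * (C1 * C2).
have C_gt1 : 1 < C by rewrite ltrDl mulr_gt0.
exists (ln C / - ln r); first by rewrite divr_gt0 // ln_gt0.
move=> x y z; set m := Num.min _ _.
have rC : r `^ (- (ln C / - ln r)) = C.
  rewrite /powR (gt_eqF rp) invrN mulrN opprK divfK.
    by rewrite lnK // posrE; lra.
  by rewrite -oppr_eq0 gt_eqF.
apply: powR_le_inj.
rewrite powRD ?(gt_eqF rp) ?implybT // rC.
have hx : r `^ gromov x z <= r `^ m by apply: le_powR; rewrite ge_min lexx.
have hz : r `^ gromov z y <= r `^ m by apply: le_powR; rewrite ge_min lexx orbT.
have h := C2P x y; have h1 := cell_dist_triangle x z y.
have h2 := C1P x z; have h3 := C1P z y.
apply: le_trans h _; apply: le_trans (_ : C2 * (C1 * r `^ m + C1 * r `^ m) <= _).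
  rewrite ler_wpM2l ?(ltW C2_gt0) //; apply: le_trans h1 _; apply: lerD.
    by apply: le_trans h2 _; rewrite ler_wpM2l // ltW.
  by apply: le_trans h3 _; rewrite ler_wpM2l // ltW.
have := powR_gt0 m rp; rewrite /C; lra.
Qed.

Let powR_lt_inj (s t : R) : r `^ s < r `^ t -> t < s.
Proof. by apply: contraTT; rewrite -!leNgt; exact: le_powR. Qed.

Let ln_r_lt0 : ln r < 0. Proof. exact: ln_lt0 r01. Qed.

Let powR_surj (s : R) : 0 < s -> exists t, r `^ t = s.
Proof.
move=> s_gt0; exists (ln s / ln r); rewrite /powR (gt_eqF r_gt0) divfK ?lnK //.
by rewrite lt_eqF.
Qed.

Lemma expr_small (eps : R) :
  0 < eps -> exists N, forall n, (N <= n)%N -> r ^+ n < eps.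
Proof.
move=> eps_gt0; have rn : `|r| < 1 by rewrite gtr0_norm.
have /cvgrPdist_lt/(_ _ eps_gt0)/near_ooP[N NP] := cvg_expr rn.
exists N => n /NP; rewrite sub0r normrN gtr0_norm //; exact: exprn_gt0.
Qed.

(** * Geodesic rays and their limit points *)

Lemma gdist_ray (x y : nat -> X) (n : nat) :
  geodesic_ray Ev o x -> geodesic_ray Ev o y ->
  (gdist E (x n.+1) (y n.+1) <= gdist E (x n) (y n) + 2)%N.
Proof.
move=> [_ _ xe] [_ _ ye]; have conn := augmented_connected.
have h1 := gdist_triangle conn (x n.+1) (x n) (y n.+1).
have h2 := gdist_triangle conn (x n) (y n) (y n.+1).
have h3 : (gdist E (x n.+1) (x n) <= 1)%N.
  by apply: gdist_edge conn _ _ _; apply: augmented_Ev; rewrite Ev_sym.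
have h4 : (gdist E (y n) (y n.+1) <= 1)%N.
  exact: gdist_edge conn _ _ (augmented_Ev _).
lia.
Qed.

(** At each step the sum of the levels grows by 2 and the distance by at most 2. *)
Lemma gromov_ray_nondecreasing (x y : nat -> X) :
  geodesic_ray Ev o x -> geodesic_ray Ev o y ->
  nondecreasing_seq (fun n => gromov (x n) (y n)).
Proof.
move=> xray yray; apply/nondecreasing_seqP => n.
have := gdist_ray n xray yray; case: xray yray => _ xl _ [_ yl _].
have nS : n.+1%:R = n%:R + 1 :> R by rewrite natr1.
rewrite /Defs.gromov !xl !yl nS -(ler_nat R) natrD; lra.
Qed.

(** For a geodesic ray, (A2) makes the points p_(x_n) converge to q. *)
Definition ray_limit (x : nat -> X) (q : 'rV[R]_d) := forall n, Phi (x n) q.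

Lemma ray_Phi_le (x : nat -> X) (m n : nat) :
  geodesic_ray Ev o x -> (m <= n)%N -> Phi (x n) `<=` Phi (x m).
Proof.
move=> xray; elim: n => [|n IHn]; first by rewrite leqn0 => /eqP->.
rewrite leq_eqVlt => /predU1P[->//|/IHn mn]; apply: subset_trans mn.
exact: PhiA1 (geodesic_ray_sons n xray).
Qed.

Lemma ray_limit_exists (x : nat -> X) :
  geodesic_ray Ev o x -> exists q, ray_limit x q.
Proof.
move=> xray.
have [q xq] : (\bigcap_n Phi (x n)) !=set0.
  apply: compact_nested_nonempty => [|n|n|n]; first exact: norm_hausdorff.
  - by have [] := PhiK (x n).
  - by have [] := PhiK (x n).
  - exact: ray_Phi_le (leqnSn n).
by exists q => n; exact: xq.
Qed.

(** The errors |p_(x_n) - q| and |p_(y_n) - q'| are absorbed by the cell sizes contained in D. *)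
Lemma enorm_le_cell_dist_ray (x y : nat -> X) (q q' : 'rV[R]_d) (n : nat) :
  ray_limit x q -> ray_limit y q' -> enorm (q - q') <= delta0 * cell_dist (x n) (y n).
Proof.
move=> xq yq; have [kp dp rp rl] := constant_bounds.
have := enorm_triangle (pt (x n)) q q'.
have := enorm_triangle (pt (y n)) (pt (x n)) q'.
have := enorm_le_Phi (xq n) (Phi_pt (x n)).
have := enorm_le_Phi (Phi_pt (y n)) (yq n).
have : enorm (pt (x n) - pt (y n)) <= delta0 * enorm (pt (x n) - pt (y n)).
  by rewrite ler_peMl ?enorm_ge0 // ltW.
rewrite /cell_dist; lra.
Qed.

Lemma cell_dist_ray_le_enorm (x y : nat -> X) (q q' : 'rV[R]_d) (n : nat) :
  geodesic_ray Ev o x -> geodesic_ray Ev o y -> ray_limit x q -> ray_limit y q' ->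
  cell_dist (x n) (y n) <= enorm (q - q') + 2 * (delta0 + 1) * r ^+ n.
Proof.
move=> [_ xl _] [_ yl _] xq yq.
have := enorm_triangle q (pt (x n)) (pt (y n)).
have := enorm_triangle q' q (pt (y n)).
have := enorm_le_Phi (Phi_pt (x n)) (xq n).
have := enorm_le_Phi (yq n) (Phi_pt (y n)).
rewrite /cell_dist xl yl; lra.
Qed.

(** * Cauchy sequences for D *)

Definition cell_cauchy (u : nat -> X) := forall eps : R, 0 < eps ->
  exists N, forall n m, (N <= n)%N -> (N <= m)%N -> cell_dist (u n) (u m) < eps.

Definition cell_null (u v : nat -> X) := forall eps : R, 0 < eps ->
  exists N, forall n, (N <= n)%N -> cell_dist (u n) (v n) < eps.

Lemma cell_null_sym (u v : nat -> X) : cell_null u v -> cell_null v u.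
Proof. by move=> uv eps /uv[N NP]; exists N => n /NP; rewrite cell_dist_sym. Qed.

Lemma cell_null_trans (u v w : nat -> X) : cell_null u v -> cell_null v w -> cell_null u w.
Proof.
move=> uv vw eps eps_gt0; have eps2 : 0 < eps / 2 by rewrite divr_gt0.
have [N NP] := uv _ eps2; have [M MP] := vw _ eps2; exists (maxn N M) => n.
rewrite geq_max => /andP[/NP h1 /MP h2].
by have := cell_dist_triangle (u n) (v n) (w n); lra.
Qed.

Lemma cell_cauchy_null (u v : nat -> X) : cell_cauchy u -> cell_null u v -> cell_cauchy v.
Proof.
move=> uc uv eps eps_gt0; have eps3 : 0 < eps / 3 by rewrite divr_gt0.
have [N NP] := uc _ eps3; have [M MP] := uv _ eps3; exists (maxn N M) => n m.
rewrite !geq_max => /andP[Nn Mn] /andP[Nm Mm].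
have h1 := NP n m Nn Nm; have h2 := MP n Mn; have h3 := MP m Mm.
have := cell_dist_triangle (v n) (u n) (v m); have := cell_dist_triangle (u n) (u m) (v m).
by rewrite (cell_dist_sym (v n) (u n)); lra.
Qed.

Lemma cell_null_refl (u : nat -> X) : cell_cauchy u -> cell_null u u.
Proof. by move=> uc eps /uc[N NP]; exists N => n Nn; exact: NP. Qed.

Lemma cell_dist_ray (x : nat -> X) (m n : nat) : geodesic_ray Ev o x -> (m <= n)%N ->
  cell_dist (x m) (x n) <= (delta0 + 2) * r ^+ m.
Proof.
move=> xray mn; have [_ xl _] := xray.
have := enorm_le_Phi (Phi_pt (x m)) (ray_Phi_le xray mn (Phi_pt (x n))).
have : r ^+ n <= r ^+ m by rewrite ler_wiXn2l ?ltW.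
rewrite /cell_dist !xl; lra.
Qed.

Lemma ray_cell_cauchy (x : nat -> X) : geodesic_ray Ev o x -> cell_cauchy x.
Proof.
move=> xray eps eps_gt0; have [kp dp rp rl] := constant_bounds.
have dp2 : 0 < delta0 + 2 by lra.
have [N NP] := expr_small (divr_gt0 eps_gt0 dp2).
have {}NP n : (N <= n)%N -> (delta0 + 2) * r ^+ n < eps.
  by move=> /NP; rewrite ltr_pdivlMr // mulrC.
exists N => n m; wlog nm : n m / (n <= m)%N => [hw|] Nn Nm.
  by have [/hw->//|/ltnW/hw] := leqP n m; rewrite cell_dist_sym; exact.
exact: le_lt_trans (cell_dist_ray xray nm) (NP n Nn).
Qed.

(** Both directions let n tend to infinity in the comparison of D(x_n, y_n) with |q - q'|. *)
Lemma cell_null_rayP (x y : nat -> X) (q q' : 'rV[R]_d) :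
  geodesic_ray Ev o x -> geodesic_ray Ev o y -> ray_limit x q -> ray_limit y q' ->
  cell_null x y <-> q = q'.
Proof.
have [kp dp rp rl] := constant_bounds.
move=> xray yray xq yq; split=> [xy|qq'].
  apply/eqP; rewrite -subr_eq0; apply/eqP/enorm_eq0/eqP.
  rewrite eq_le enorm_ge0 andbT; apply/ler_addgt0Pr => eps eps_gt0.
  rewrite add0r; have [N NP] := xy _ (divr_gt0 eps_gt0 delta0_gt0).
  apply: le_trans (enorm_le_cell_dist_ray N xq yq) _.
  by have := NP N (leqnn N); rewrite ltr_pdivlMr // mulrC => /ltW.
move=> eps eps_gt0; have dp2 : 0 < 2 * (delta0 + 1) by lra.
have [N NP] := expr_small (divr_gt0 eps_gt0 dp2).
exists N => n /NP; rewrite ltr_pdivlMr // mulrC; apply: le_lt_trans.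
have := cell_dist_ray_le_enorm n xray yray xq yq.
by rewrite qq' subrr enorm0 add0r.
Qed.

(** The case n = m of [cell_cauchy] counts here: D(u_n, u_n) dominates r^|u_n|. *)
Lemma cell_cauchy_level (u : nat -> X) : cell_cauchy u ->
  forall L, exists N, forall n, (N <= n)%N -> (L <= lev (u n))%N.
Proof.
move=> uc L; have [N NP] := uc _ (exprn_gt0 L r_gt0); exists N => n Nn.
have := le_lt_trans (expr_level_le_cell_dist (u n) (u n)) (NP n n Nn Nn).
by apply: contraTT; rewrite -ltnNge -leNgt => /ltnW nL; rewrite ler_wiXn2l ?ltW.
Qed.

(** In the ray given by [koenig], x_n is an ancestor of some u_m with m >= n; so p_(u_m) lies in
    Phi(x_n) and D(x_n, u_m) is of order r^n, while D(u_m, u_n) is small. *)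
Lemma cell_cauchy_ray (u : nat -> X) : locally_finite_graph Ev -> cell_cauchy u ->
  exists2 x, geodesic_ray Ev o x & cell_null x u.
Proof.
move=> Ev_lf uc; have [kp dp rp rl] := constant_bounds.
have [x xray xP] := koenig Ev_tree Ev_lf (cell_cauchy_level uc); exists x => //.
move=> eps eps_gt0; have eps2 : 0 < eps / 2 by rewrite divr_gt0.
have dp2 : 0 < delta0 + 2 by lra.
have [N NP] := uc _ eps2; have [M MP] := expr_small (divr_gt0 eps2 dp2).
exists (maxn N M) => n; rewrite geq_max => /andP[Nn /MP].
rewrite ltr_pdivlMr // => rn.
have [m nm [le_n xE]] := xP n n.
have h1 := NP m n (leq_trans Nn nm) Nn.
have h2 := cell_dist_triangle (x n) (u m) (u n).
have um : Phi (x n) (pt (u m)).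
  by rewrite xE; exact: Phi_iter_parent (leq_subr _ _) _ (Phi_pt _).
have h3 := enorm_le_Phi (Phi_pt (x n)) um.
have h4 : r ^+ lev (u m) <= r ^+ n by rewrite ler_wiXn2l ?ltW.
have [_ xl _] := xray; rewrite xl in h3.
have : cell_dist (x n) (u m) < eps / 2 by rewrite /cell_dist xl; lra.
lra.
Qed.

(** * The hyperbolic boundary *)

Variables (a : R) (a_gt0 : 0 < a).
Notation rho := (rho Ev E o a).
Notation cauchy_class := (cauchy_class Ev E o a).
Notation rho_cauchy := (rho_cauchy Ev E o a).
Notation boundary := (boundary Ev E o a).
Notation converges_to := (converges_to Ev E o a).

Lemma rho_ge0 (x y : X) : 0 <= rho x y.
Proof. by rewrite /Defs.rho; case: ifP => // _; exact: expR_ge0. Qed.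

Lemma rho_lt_of_cell_dist (eps : R) : 0 < eps ->
  exists2 eta : R, 0 < eta & forall x y, cell_dist x y < eta -> rho x y < eps.
Proof.
move=> eps_gt0; have [C C_gt0 CP] := powR_gromov_le_cell_dist.
(* A Gromov product above -(ln eps)/a is what makes rho smaller than eps. *)
exists (r `^ (- (ln eps / a)) / C); first by rewrite divr_gt0 ?powR_gt0.
move=> x y; rewrite ltr_pdivlMr // mulrC => /(le_lt_trans (CP x y)) /powR_lt_inj.
rewrite /Defs.rho; case: ifP => // _; rewrite ltrNl ltr_pdivlMr // => h.
rewrite -[ltRHS]lnK ?posrE // ltr_expR; lra.
Qed.

(* The case x = y is apart because rho x x = 0, whereas cell_dist x x > 0. *)
Lemma cell_dist_lt_of_rho (eps : R) : 0 < eps ->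
  exists2 eta : R, 0 < eta & forall x y, rho x y < eta -> x = y \/ cell_dist x y < eps.
Proof.
move=> eps_gt0; have [C C_gt0 CP] := cell_dist_le_powR_gromov.
(* With C r^t = eps/2, the bound exp(-a t) on rho forces a Gromov product above t. *)
have [t tE] : exists t, r `^ t = eps / (2 * C).
  by apply: powR_surj; rewrite divr_gt0 // mulr_gt0.
exists (expR (- (a * t))); first exact: expR_gt0.
move=> x y; rewrite /Defs.rho; case: eqP => [->|_]; first by left.
rewrite ltr_expR ltrN2 ltr_pM2l // => /ltW/le_powR; rewrite tE => h.
right; apply: le_lt_trans (CP x y) _.
apply: le_lt_trans (_ : C * (eps / (2 * C)) < _); first by rewrite ler_wpM2l // ltW.
have -> : C * (eps / (2 * C)) = eps / 2 by field; rewrite gt_eqF.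
lra.
Qed.

Lemma rho_cauchyP (u : nat -> X) : rho_cauchy u <->
  forall eps : R, 0 < eps ->
    exists N, forall n m, (N <= n)%N -> (N <= m)%N -> rho (u n) (u m) < eps.
Proof. by split=> h eps /h /near_oo2P. Qed.

Lemma rho_equivP (u v : nat -> X) : rho_equiv Ev E o a u v <->
  forall eps : R, 0 < eps -> exists N, forall n, (N <= n)%N -> rho (u n) (v n) < eps.
Proof.
have rhoE n : `|0 - rho (u n) (v n)| = rho (u n) (v n).
  by rewrite sub0r normrN ger0_norm // rho_ge0.
split=> [/cvgrPdist_lt h eps /h /near_ooP[N NP]|h].
  by exists N => n /NP; rewrite rhoE.
apply/cvgrPdist_lt => eps /h[N NP]; apply/near_ooP; exists N => n /NP.
by rewrite rhoE.
Qed.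

Lemma cell_cauchy_rho_cauchy (u : nat -> X) : cell_cauchy u -> rho_cauchy u.
Proof.
move=> uc; apply/rho_cauchyP => eps /rho_lt_of_cell_dist[eta /uc[N NP] etaP].
by exists N => n m Nn Nm; apply/etaP/NP.
Qed.

Lemma cauchy_classP (u v : nat -> X) : cell_cauchy u ->
  cauchy_class u v <-> cell_null u v.
Proof.
move=> uc; split=> [[_ /rho_equivP uv] eps eps_gt0|uv]; last first.
  split; first exact/cell_cauchy_rho_cauchy/(cell_cauchy_null uc).
  apply/rho_equivP => eps /rho_lt_of_cell_dist[eta /uv[N NP] etaP].
  by exists N => n Nn; apply/etaP/NP.
have [eta eta_gt0 etaP] := cell_dist_lt_of_rho eps_gt0.
have [N NP] := uv _ eta_gt0; have [M MP] := uc _ eps_gt0.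
exists (maxn N M) => n; rewrite geq_max => /andP[Nn Mn].
(* If u_n = v_n, the Cauchy property with equal indices bounds D(u_n, u_n). *)
by have [<-|//] := etaP _ _ (NP n Nn); exact: MP.
Qed.

Lemma cauchy_class_eq (u v : nat -> X) : cell_cauchy u -> cell_null u v ->
  cauchy_class u = cauchy_class v.
Proof.
move=> uc uv; have vc := cell_cauchy_null uc uv.
apply/seteqP; split=> w /cauchy_classP h; apply/cauchy_classP => //.
  by apply: cell_null_trans (cell_null_sym uv) _; exact: h.
by apply: cell_null_trans uv _; exact: h.
Qed.

Lemma rho_cauchy_level_lt (u : nat -> X) (L : nat) : rho_cauchy u ->
    ~ (exists x, cauchy_class u = cauchy_class (fun=> x)) ->
  exists N, forall n, (N <= n)%N -> (L < lev (u n))%N.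
Proof.
(* A point at rho-distance less than exp(-aL) from x with |x| <= L is x itself. *)
move=> /rho_cauchyP uc u_lim.
have [N NP] := uc _ (expR_gt0 (- (a * L%:R))); exists N => n Nn.
rewrite ltnNge; apply/negP => nL; apply: u_lim; exists (u n).
have uE m : (N <= m)%N -> u m = u n.
  move=> Nm; apply: contrapT => /eqP; rewrite eq_sym => /negPf nm.
  have := NP n m Nn Nm; rewrite /Defs.rho nm ltr_expR ltrN2 ltr_pM2l //.
  have [gn _] := gromov_le_level (u n) (u m); rewrite ltNge => /negP; apply.
  by apply: le_trans gn _; rewrite ler_nat.
apply/seteqP; split=> w [wc /rho_equivP uw]; split=> //; apply/rho_equivP;
  move=> eps /uw[M MP]; exists (maxn N M) => m; rewrite geq_max => /andP[Nm Mm].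
  by rewrite -(uE m Nm) MP.
by rewrite (uE m Nm) MP.
Qed.

(** A Cauchy sequence for rho outside the classes of vertices has levels tending to infinity, so
    that D(u_n, u_n) tends to 0 as well. *)
Lemma boundaryP (xi : set (nat -> X)) :
  boundary xi <-> exists2 u, cell_cauchy u & xi = cauchy_class u.
Proof.
split=> [[[u uc <-] u_lim]|[u uc ->]].
  exists u => // eps eps_gt0.
  have [eta eta_gt0 etaP] := cell_dist_lt_of_rho eps_gt0.
  have /rho_cauchyP/(_ _ eta_gt0)[N NP] := uc.
  have eps2 : 0 < eps / 2 by rewrite divr_gt0.
  have [L LP] := expr_small eps2.
  have [|M MP] := @rho_cauchy_level_lt u L uc.
    by move=> [x ux]; apply: u_lim; exists x.
  exists (maxn N M) => n m; rewrite !geq_max => /andP[Nn Mn] /andP[Nm Mm].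
  have [<-|//] := etaP _ _ (NP n m Nn Nm).
  by rewrite /cell_dist subrr enorm0 add0r; have := LP _ (ltnW (MP n Mn)); lra.
split; first by exists u => //; exact: cell_cauchy_rho_cauchy.
(* Otherwise the constant sequence x would be Cauchy for D, although D(x, x) > 0. *)
move=> [x _ xu].
have : cauchy_class (fun=> x) (fun=> x).
  split; first by apply/rho_cauchyP => eps; exists 0%N; rewrite /Defs.rho eqxx.
  by apply/rho_equivP => eps; exists 0%N; rewrite /Defs.rho eqxx.
rewrite xu => /(cauchy_classP _ uc) ux.
have [N NP] := cell_cauchy_null uc ux (cell_dist_gt0 x x).
by have := NP N N (leqnn N) (leqnn N); rewrite ltxx.
Qed.

Lemma converges_toP (x u : nat -> X) : cell_cauchy x -> cell_cauchy u ->
  converges_to x (cauchy_class u) <-> cell_null x u.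
Proof.
move=> xc uc; split=> [xu eps eps_gt0|xu v /(cauchy_classP _ uc) uv eps eps_gt0].
  have eps2 : 0 < eps / 2 by rewrite divr_gt0.
  have uu : cauchy_class u u by apply/(cauchy_classP _ uc)/cell_null_refl.
  have [eta eta_gt0 etaP] := cell_dist_lt_of_rho eps2.
  have /near_ooP[N NP] := xu _ uu _ eta_gt0.
  have [M MP] := uc _ eps2.
  exists (maxn N M) => n; rewrite geq_max => /andP[Nn Mn].
  have /near_ooP[K KP] := NP n Nn.
  (* K depends on n; an index beyond both K and M gives a point of u close to x_n for rho and to u_n
     for D. *)
  have h := KP (maxn K M) (leq_maxl _ _).
  have uK := MP _ n (leq_maxr K M) Mn.
  have [->|xuK] := etaP _ _ h; first lra.
  by have := cell_dist_triangle (x n) (u (maxn K M)) (u n); lra.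
have eps2 : 0 < eps / 2 by rewrite divr_gt0.
have [eta eta_gt0 etaP] := rho_lt_of_cell_dist eps_gt0.
have eta2 : 0 < eta / 2 by rewrite divr_gt0.
have vc := cell_cauchy_null uc uv.
have [N NP] := cell_null_trans xu uv eta2; have [M MP] := vc _ eta2.
apply/near_ooP; exists (maxn N M) => n; rewrite geq_max => /andP[Nn Mn].
apply/near_ooP; exists M => m Mm; apply: etaP.
have := NP n Nn; have := MP n m Mn Mm; have := cell_dist_triangle (x n) (v n) (v m).
lra.
Qed.

Lemma ray_converges_to (x : nat -> X) (xi : set (nat -> X)) : boundary xi ->
  geodesic_ray Ev o x -> converges_to x xi <-> xi = cauchy_class x.
Proof.
move=> /boundaryP[u uc ->] /ray_cell_cauchy xc; split=> [/(converges_toP xc uc) xu|->].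
  by apply: cauchy_class_eq => //; exact: cell_null_sym.
exact/(converges_toP xc xc)/cell_null_refl.
Qed.

(** * The map iota and the comparison of metrics *)

Hypothesis Ev_lf : locally_finite_graph Ev.

Lemma boundary_ray (xi : set (nat -> X)) : boundary xi ->
  exists2 x, geodesic_ray Ev o x & converges_to x xi.
Proof.
move=> /boundaryP[u uc ->]; have [x xray xu] := cell_cauchy_ray Ev_lf uc.
by exists x => //; apply/converges_toP => //; exact: ray_cell_cauchy.
Qed.

(** A choice among the limit points of all rays converging to xi; [ray_limit_iota] shows that the
    ray does not matter. *)
Definition iota (xi : set (nat -> X)) : 'rV[R]_d := xget 0 [set q |
  exists x, [/\ geodesic_ray Ev o x, converges_to x xi & ray_limit x q]].

Lemma ray_limit_unique (x : nat -> X) (q q' : 'rV[R]_d) : geodesic_ray Ev o x ->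
  ray_limit x q -> ray_limit x q' -> q = q'.
Proof.
move=> xray xq xq'; apply/(cell_null_rayP xray xray xq xq').
exact/cell_null_refl/ray_cell_cauchy.
Qed.

(** Two rays converging to xi have the same class, so D between them tends to 0 and their limit
    points agree. *)
Lemma ray_limit_iota (xi : set (nat -> X)) (x : nat -> X) : boundary xi ->
  geodesic_ray Ev o x -> converges_to x xi -> ray_limit x (iota xi).
Proof.
move=> bxi xray xxi; have [q xq] := ray_limit_exists xray.
rewrite /iota; case: xgetP => [q' _ [y [yray yxi yq']]|/(_ q)]; last first.
  by case; exists x.
suff -> : q' = q by [].
apply/(cell_null_rayP yray xray yq' xq)/(cauchy_classP x (ray_cell_cauchy yray)).
move/(ray_converges_to bxi yray): yxi => <-.
move/(ray_converges_to bxi xray): xxi => ->.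
exact/(cauchy_classP _ (ray_cell_cauchy xray))/cell_null_refl/ray_cell_cauchy.
Qed.

Lemma bigcap_ray (xi : set (nat -> X)) (x : nat -> X) : boundary xi ->
  geodesic_ray Ev o x -> converges_to x xi -> \bigcap_n Phi (x n) = [set iota xi].
Proof.
move=> bxi xray xxi; have xq := ray_limit_iota bxi xray xxi.
apply/seteqP; split=> [q xq'|_ -> n _]; last exact: xq.
by apply: ray_limit_unique xray _ xq => n; exact: xq'.
Qed.

Lemma iota_attractor (xi : set (nat -> X)) :
  boundary xi -> attractor Ev o Phi (iota xi).
Proof.
move=> bxi; have [x xray xxi] := boundary_ray bxi; have [_ xl _] := xray.
by move=> n _; exists (x n); [exact: xl|exact: ray_limit_iota xxi n].
Qed.

Lemma iota_inj (xi eta : set (nat -> X)) :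
  boundary xi -> boundary eta -> iota xi = iota eta -> xi = eta.
Proof.
move=> bxi beta xe; have [x xray xxi] := boundary_ray bxi.
have [y yray yeta] := boundary_ray beta.
have xq := ray_limit_iota bxi xray xxi; have yq := ray_limit_iota beta yray yeta.
have -> := (ray_converges_to bxi xray).1 xxi.
have -> := (ray_converges_to beta yray).1 yeta.
apply: cauchy_class_eq (ray_cell_cauchy xray) _.
exact: (cell_null_rayP xray yray xq yq).2 xe.
Qed.

(** The vertices u_n at level n whose cells contain q need not form a ray; [koenig] yields a ray of
    ancestors, whose cells contain q by (A1). *)
Lemma iota_surj (q : 'rV[R]_d) : attractor Ev o Phi q ->
  exists2 xi, boundary xi & iota xi = q.
Proof.
move=> Kq.
have /choice[u uP] n : exists x, lev x = n /\ Phi x q.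
  by have [x xn xq] := Kq n I; exists x.
have u_level N : exists n, forall m, (n <= m)%N -> (N <= lev (u m))%N.
  by exists N => m; have [->] := uP m.
have [x xray xP] := koenig Ev_tree Ev_lf u_level.
have xq : ray_limit x q.
  move=> n; have [m _ [_ ->]] := xP n 0%N.
  by apply: Phi_iter_parent (leq_subr _ _) _ _; have [] := uP m.
have xc := ray_cell_cauchy xray.
have bx : boundary (cauchy_class x) by apply/boundaryP; exists x.
exists (cauchy_class x) => //; apply: (ray_limit_unique xray _ xq).
apply: (ray_limit_iota bx xray); exact/(ray_converges_to bx xray).
Qed.

Lemma iota_bij : set_bij boundary (attractor Ev o Phi) iota.
Proof.
split=> [xi|xi eta|q /iota_surj[xi bxi <-]]; first exact: iota_attractor.
  by rewrite !inE; exact: iota_inj.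
by exists xi.
Qed.

(** For all pairs of rays the limit of the Gromov products lies in one interval [t, s] fixed by
    |iota xi - iota eta|, so the infimum is finite and lies there too. *)
Lemma gromov_bdy_bounds :
  exists2 C : R, 0 < C & forall xi eta, boundary xi -> boundary eta -> xi <> eta ->
    exists2 g : R, gromov_bdy Ev E o a xi eta = g%:E &
      C^-1 * enorm (iota xi - iota eta) <= r `^ g <= C * enorm (iota xi - iota eta).
Proof.
have [kp dp rp rl] := constant_bounds.
have [C1 C1_gt0 C1P] := cell_dist_le_powR_gromov; have [C2 C2_gt0 C2P] := powR_gromov_le_cell_dist.
have dC : 0 < delta0 * C1 by rewrite mulr_gt0.
exists (delta0 * C1 + 2 * C2) => [|xi eta bxi beta xi_eta]; first lra.
set q := iota xi; set q' := iota eta; set Delta := enorm (q - q').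
have Delta_gt0 : 0 < Delta.
  rewrite lt_def enorm_ge0 andbT; apply/eqP => /enorm_eq0/eqP.
  by rewrite subr_eq0 => /eqP/(iota_inj bxi beta).
(* As r < 1, the upper end s comes from the lower bound on r^g, and t from the upper one. *)
have [s sE] : exists s, r `^ s = (delta0 * C1)^-1 * Delta.
  by apply: powR_surj; rewrite mulr_gt0 // invr_gt0.
have [t tE] : exists t, r `^ t = 2 * C2 * Delta.
  by apply: powR_surj; rewrite !mulr_gt0.
have bound x y : geodesic_ray Ev o x -> converges_to x xi ->
    geodesic_ray Ev o y -> converges_to y eta ->
    (t%:E <= limn (fun n => (gromov (x n) (y n))%:E) <= s%:E)%E.
  move=> xray xxi yray yeta.
  have xq := ray_limit_iota bxi xray xxi; have yq := ray_limit_iota beta yray yeta.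
  have cvg_g : cvgn (fun n => (gromov (x n) (y n))%:E).
    apply: ereal_nondecreasing_is_cvgn => m n mn.
    by rewrite lee_fin; exact: gromov_ray_nondecreasing.
  apply/andP; split; [apply: lime_ge => //|apply: lime_le => //].
    (* For large n the error 2 (delta0 + 1) r^n is below [Delta], so D(x_n, y_n) <= 2 [Delta]; hence
       the 2 in r^t. *)
    have dp2 : 0 < 2 * (delta0 + 1) by lra.
    have [N NP] := expr_small (divr_gt0 Delta_gt0 dp2).
    exists N => // n /= /NP; rewrite ltr_pdivlMr // => rn.
    rewrite lee_fin; apply: powR_le_inj; rewrite tE; apply: le_trans (C2P _ _) _.
    rewrite [2 * C2]mulrC -mulrA ler_wpM2l ?(ltW C2_gt0) //.
    by have := cell_dist_ray_le_enorm n xray yray xq yq; rewrite -/Delta; lra.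
  apply: nearW => n; rewrite lee_fin; apply: powR_le_inj; rewrite sE.
  rewrite ler_pdivrMl //; apply: le_trans (enorm_le_cell_dist_ray n xq yq) _.
  by rewrite -mulrA ler_wpM2l // ltW.
have [x xray xxi] := boundary_ray bxi; have [y yray yeta] := boundary_ray beta.
have /andP[t_le le_s] : (t%:E <= gromov_bdy Ev E o a xi eta <= s%:E)%E.
  have /andP[_ le_s] := bound x y xray xxi yray yeta.
  apply/andP; split.
    apply: le_ereal_inf_tmp => _ [x' [y' [[x'ray x'xi] [y'ray y'eta] ->]]].
    by have /andP[] := bound x' y' x'ray x'xi y'ray y'eta.
  by apply: le_trans le_s; apply: ereal_inf_lbound; exists x, y.
have g_fin : gromov_bdy Ev E o a xi eta \is a fin_num.
  by rewrite fin_numElt (lt_le_trans (ltNyr t)) //= (le_lt_trans le_s) // ltry.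
exists (fine (gromov_bdy Ev E o a xi eta)); first by rewrite fineK.
move: t_le le_s; rewrite -(fineK g_fin) !lee_fin /= => /le_powR + /le_powR.
rewrite tE sE => h1 h2; apply/andP; split.
  apply: le_trans h2; rewrite ler_wpM2r ?(ltW Delta_gt0) // lef_pV2 ?posrE //; lra.
apply: le_trans h1 _; rewrite ler_wpM2r ?(ltW Delta_gt0) //; lra.
Qed.

(** The power -(ln r)/a of exp(-a g) is exp(g ln r). *)
Lemma rho_bdy_powR (xi eta : set (nat -> X)) (g : R) : xi <> eta ->
  gromov_bdy Ev E o a xi eta = g%:E ->
  rho_bdy Ev E o a xi eta `^ (- ln r / a) = r `^ g.
Proof.
move=> /eqP/negPf xe gE; rewrite /rho_bdy xe gE /=.
rewrite /powR !gt_eqF ?expR_gt0 // expRK; congr expR.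
by field; rewrite gt_eqF.
Qed.

End AugmentedTree.

Theorem theorem1p3 (R : realType) (d : nat) (X : choiceType)
    (Ev : rel X) (o : X) (Phi : X -> set 'rV[R]_d) (delta0 r kappa : R)
    (Xinf : infinite_set [set: X]) (Ev_lf : locally_finite_graph Ev)
    (Ev_tree : is_tree Ev)
    (PhiK : forall x : X, Phi x !=set0 /\ compact (Phi x))
    (delta0_gt1 : 1 < delta0) (r01 : 0 < r < 1)
    (PhiA1 : condA1 Ev o Phi) (PhiA2 : condA2 Ev o Phi delta0 r)
    (kappa_gt0 : 0 < kappa) :
  let E := augmented Ev o Phi r kappa in
  let K := attractor Ev o Phi in
  (exists2 delta : R, 0 < delta & hyperbolic Ev E o delta) /\
  forall delta a : R, 0 < delta -> hyperbolic Ev E o delta ->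
    0 < a -> expR (3 * delta * a) < Num.sqrt 2 ->
    let dX := boundary Ev E o a in
    let beta := - ln r / a in
    exists iota : set (nat -> X) -> 'rV[R]_d,
      [/\ forall xi, dX xi ->
            exists2 x, geodesic_ray Ev o x & converges_to Ev E o a x xi,
          forall xi x, dX xi ->
            geodesic_ray Ev o x -> converges_to Ev E o a x xi ->
            \bigcap_n Phi (x n) = [set iota xi],
          set_bij dX K iota &
          exists2 C : R, 0 < C & forall xi eta, dX xi -> dX eta ->
            C^-1 * enorm (iota xi - iota eta)
              <= rho_bdy Ev E o a xi eta `^ beta
              <= C * enorm (iota xi - iota eta)].
Proof.
move=> E K; split.
  exact: (augmented_hyperbolic Ev_tree PhiK delta0_gt1 r01 PhiA1 PhiA2 kappa_gt0).
move=> delta a _ _ a_gt0 _ dX beta; exists (iota Ev o Phi r kappa a); split.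
- exact: (boundary_ray Ev_tree PhiK delta0_gt1 r01 PhiA1 PhiA2 kappa_gt0 a_gt0).
- exact: (bigcap_ray Ev_tree PhiK delta0_gt1 r01 PhiA1 PhiA2 kappa_gt0 a_gt0).
- exact: (iota_bij Ev_tree PhiK delta0_gt1 r01 PhiA1 PhiA2 kappa_gt0 a_gt0).
have [C C_gt0 CP] := gromov_bdy_bounds Ev_tree PhiK delta0_gt1 r01 PhiA1 PhiA2
  kappa_gt0 a_gt0 Ev_lf.
exists C => // xi eta dxi deta; have [<-|/eqP xi_eta] := eqVneq xi eta.
  (* All terms vanish for xi = eta: beta is nonzero, so 0 to the power beta is 0. *)
  rewrite /rho_bdy eqxx subrr enorm0 !mulr0 powR0 ?lexx //.
  by rewrite gt_eqF // divr_gt0 // oppr_gt0 ln_lt0.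
have [g gE gP] := CP xi eta dxi deta xi_eta.
by rewrite /beta (rho_bdy_powR _ a_gt0 xi_eta gE).
Qed.
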